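(* Let $N\ge 1$ and $m\in\{1,2,3\}$. Let real coefficients $(T_{1m})_{i,j,k}$ ($0\le i\le N$, $1\le j,k\le N$), $(T_{2m})_{i,j,k}$ ($0\le j\le N$, $1\le i,k\le N$), $(T_{3m})_{i,j,k}$ ($0\le k\le N$, $1\le i,j\le N$) and $(F_m)_{i,j,k}$ ($1\le i,j,k\le N$) be given, and define on $[-1,1]^3$ the discrete stress components and body force $$\sigma_{1m}^{h}=\sum_{i=0}^{N}\sum_{j=1}^{N}\sum_{k=1}^{N}(T_{1m})_{i,j,k}\,h_i(\xi_1)e_j(\xi_2)e_k(\xi_3),\qquad \sigma_{2m}^{h}=\sum_{i=1}^{N}\sum_{j=0}^{N}\sum_{k=1}^{N}(T_{2m})_{i,j,k}\,e_i(\xi_1)h_j(\xi_2)e_k(\xi_3),$$ $$\sigma_{3m}^{h}=\sum_{i=1}^{N}\sum_{j=1}^{N}\sum_{k=0}^{N}(T_{3m})_{i,j,k}\,e_i(\xi_1)e_j(\xi_2)h_k(\xi_3),\qquad f_m^{h}=\sum_{i=1}^{N}\sum_{j=1}^{N}\sum_{k=1}^{N}(F_m)_{i,j,k}\,e_i(\xi_1)e_j(\xi_2)e_k(\xi_3).$$ Then the discrete translational equilibrium $$\frac{\partial\sigma_{1m}^{h}}{\partial\xi_1}+\frac{\partial\sigma_{2m}^{h}}{\partial\xi_2}+\frac{\partial\sigma_{3m}^{h}}{\partial\xi_3}+f_m^{h}=0$$ holds at every point $(\xi_1,\xi_2,\xi_3)\in[-1,1]^3$ if and only if, for all $i,j,k=1,\dots,N$,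 $$(T_{1m})_{i,j,k}-(T_{1m})_{i-1,j,k}+(T_{2m})_{i,j,k}-(T_{2m})_{i,j-1,k}+(T_{3m})_{i,j,k}-(T_{3m})_{i,j,k-1}+(F_m)_{i,j,k}=0.$$
   Context: Let $-1=\xi_0<\xi_1<\dots<\xi_N=1$ be the $N+1$ Gauss–Lobatto–Legendre nodes on $[-1,1]$ (here the subscript on a node is the node index; in the claim, $\xi_1,\xi_2,\xi_3$ denote the three coordinates). The Lagrange polynomials $h_0,\dots,h_N$ are the polynomials of degree $N$ with $h_i(\xi_j)=\delta_{i,j}$. The edge polynomials $e_1,\dots,e_N$ are the polynomials of degree $N-1$ defined by $$e_i(\xi)=-\sum_{k=0}^{i-1}\frac{\mathrm{d}h_k(\xi)}{\mathrm{d}\xi},\qquad i=1,\dots,N;$$ they satisfy $\int_{\xi_{k-1}}^{\xi_k}e_i(\xi)\,\mathrm{d}\xi=\delta_{i,k}$. The expansion coefficients $T_{nm}$ are the integrated traction components (surface forces) over the faces of the sub-cells of the nodal grid, and $F_m$ are the body force components integrated over the sub-cells. *)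

(* Defs.v *)
From mathcomp Require Import all_boot all_order all_algebra.
From mathcomp Require Import all_classical all_reals all_analysis.
Import Order.TTheory GRing.Theory Num.Theory.
Import numFieldNormedType.Exports.

Set Implicit Arguments.
Unset Strict Implicit.
Unset Printing Implicit Defensive.

Local Open Scope ring_scope.

(* Families indexed by a range of naturals ([0, N] for nodes and Lagrange      *)
(* polynomials, [1, N] for edge polynomials) are functions on nat; only the    *)
(* values on that range are ever constrained or used.                          *)

(* Rodrigues' formula. *)
Definition legendre (R : realType) (N : nat) : {poly R} :=
  (2 ^+ N * (N`!)%:R)^-1 *: (('X ^+ 2 - 1) ^+ N)^`(N).

(* The nodes are the end points -1, 1 and the zeros of L_N', in increasing     *)
(* order. As deg L_N' = N - 1, this determines xi 0, ..., xi N uniquely.       *)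
Definition GLL_nodes (R : realType) (N : nat) (xi : nat -> R) : Prop :=
  [/\ xi 0%N = -1,
      xi N = 1,
      (forall i j : nat, (i < j <= N)%N -> xi i < xi j) &
      (forall i : nat, (0 < i < N)%N -> root (legendre R N)^`() (xi i))].

Definition lagrange_polys (R : realType) (N : nat) (xi : nat -> R)
    (h : nat -> {poly R}) : Prop :=
  forall i : nat, (i <= N)%N ->
    size (h i) = N.+1 /\
    forall j : nat, (j <= N)%N -> (h i).[xi j] = (i == j)%:R.

Definition edge_poly (R : realType) (h : nat -> {poly R}) (i : nat) : {poly R} :=
  - \sum_(0 <= k < i) (h k)^`().

Definition stress1 (R : realType) (N : nat) (h : nat -> {poly R})
    (T : nat -> nat -> nat -> R) (x1 x2 x3 : R) : R :=
  \sum_(0 <= i < N.+1) \sum_(1 <= j < N.+1) \sum_(1 <= k < N.+1)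
    T i j k * (h i).[x1] * (edge_poly h j).[x2] * (edge_poly h k).[x3].

Definition stress2 (R : realType) (N : nat) (h : nat -> {poly R})
    (T : nat -> nat -> nat -> R) (x1 x2 x3 : R) : R :=
  \sum_(1 <= i < N.+1) \sum_(0 <= j < N.+1) \sum_(1 <= k < N.+1)
    T i j k * (edge_poly h i).[x1] * (h j).[x2] * (edge_poly h k).[x3].

Definition stress3 (R : realType) (N : nat) (h : nat -> {poly R})
    (T : nat -> nat -> nat -> R) (x1 x2 x3 : R) : R :=
  \sum_(1 <= i < N.+1) \sum_(1 <= j < N.+1) \sum_(0 <= k < N.+1)
    T i j k * (edge_poly h i).[x1] * (edge_poly h j).[x2] * (h k).[x3].

Definition body_force (R : realType) (N : nat) (h : nat -> {poly R})
    (F : nat -> nat -> nat -> R) (x1 x2 x3 : R) : R :=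
  \sum_(1 <= i < N.+1) \sum_(1 <= j < N.+1) \sum_(1 <= k < N.+1)
    F i j k * (edge_poly h i).[x1] * (edge_poly h j).[x2] * (edge_poly h k).[x3].

(* Partial derivatives of functions defined on all of R^3. The stress fields   *)
(* are polynomial, so on the boundary of the cube these two-sided derivatives  *)
(* agree with the one-sided ones.                                              *)
Definition partial1 (R : realType) (f : R -> R -> R -> R) (x1 x2 x3 : R) : R :=
  derive1 (fun x : R => f x x2 x3) x1.
Definition partial2 (R : realType) (f : R -> R -> R -> R) (x1 x2 x3 : R) : R :=
  derive1 (fun x : R => f x1 x x3) x2.
Definition partial3 (R : realType) (f : R -> R -> R -> R) (x1 x2 x3 : R) : R :=
  derive1 (fun x : R => f x1 x2 x) x3.

(* Main.v *)
Require Import Defs.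
From mathcomp Require Import all_boot all_order all_algebra.
From mathcomp Require Import all_classical all_reals all_analysis.
From mathcomp Require Import ring.
Import Order.TTheory GRing.Theory Num.Theory.
Import numFieldNormedType.Exports.
Local Open Scope ring_scope.

(** The edge polynomials are built so that differentiating a nodal expansion
    takes differences of its coefficients: since
    [edge_poly h i.+1 = edge_poly h i - (h i)^`()], and both [edge_poly h 0] and
    [edge_poly h N.+1] vanish (the Lagrange polynomials sum to 1), Abel summation
    gives [(\sum_i a i h_i)' = \sum_i (a i - a i.-1) e_i] ([deriv_nodal]).
    Applied in each direction, this writes the left-hand side of the
    equilibrium equation as the expansion, in the products
    [e_i(x1) e_j(x2) e_k(x3)], of the array of discrete balances
    ([partial1_stress1], [partial2_stress2], [partial3_stress3]).

    It remains to see that these products are linearly independent on the cube,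
    which reduces, one variable at a time, to independence of the [e_i] on
    [[-1, 1]] ([edge_poly_free]). If [\sum_i c i e_i] vanishes there, it is the
    zero polynomial; by the formula above it is the derivative of the nodal
    polynomial with value [\sum_(1 <= l <= i) c l] at the node [xi i], which is
    therefore constant, so that all the differences [c i] are zero. *)

Lemma deriv_eq0_const (R : numDomainType) (p : {poly R}) (x y : R) :
  p^`() = 0 -> p.[x] = p.[y].
Proof.
move=> dp0; suff -> : p = (p`_0)%:P by rewrite !hornerC.
apply/polyP => -[|i]; rewrite coefC //=.
move/polyP/(_ i): dp0; rewrite coef_deriv coef0 => /eqP.
by rewrite mulrn_eq0 => /eqP.
Qed.

Lemma poly_eq0_itv (R : realFieldType) (p : {poly R}) :
  (forall x, -1 <= x <= 1 -> p.[x] = 0) -> p = 0.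
Proof.
move=> p0.
(* The points 1, 1/2, 1/3, ... provide as many distinct roots as needed. *)
pose s := [seq (i.+1%:R)^-1 : R | i <- iota 0 (size p)].
apply: (@roots_geq_poly_eq0 _ _ s); last by rewrite size_map size_iota.
- apply/allP => _ /mapP[i _ ->]; apply/eqP/p0.
  rewrite (le_trans (lerN10 R)) ?invr_ge0 ?ler0n //=.
  by rewrite invf_le1 ?ltr0Sn // ler1n.
- rewrite map_inj_uniq ?iota_uniq // => i j /invr_inj/eqP.
  by rewrite eqr_nat => /eqP[].
Qed.

Section Edge.
Variables (R : realType) (N : nat) (xi : nat -> R) (h : nat -> {poly R}).
Hypothesis xi_inj : {in [pred i | (i <= N)%N] &, injective xi}.
Hypothesis hh : lagrange_polys N xi h.

Lemma horner_nodal (a : nat -> R) j : (j <= N)%N ->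
  (\sum_(0 <= i < N.+1) a i *: h i).[xi j] = a j.
Proof.
move=> jN; rewrite horner_sum (bigD1_seq j) ?iota_uniq ?mem_index_iota //=.
have [_ hj] := hh j jN; rewrite hornerZ hj // eqxx mulr1.
rewrite big_nat_cond big1 ?addr0 // => i /andP[/= iN ij].
by have [_ hi] := hh i iN; rewrite hornerZ hi // (negPf ij) mulr0.
Qed.

Lemma sum_lagrange : \sum_(0 <= i < N.+1) h i = 1.
Proof.
apply/eqP; rewrite -subr_eq0; apply/eqP.
apply: (@roots_geq_poly_eq0 _ _ [seq xi i | i <- iota 0 N.+1]).
- apply/allP => _ /mapP[j + ->]; rewrite mem_iota /= => jN.
  apply/eqP; rewrite hornerD hornerN hornerC.
  under eq_bigr => i _ do rewrite -[h i]scale1r.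
  by rewrite (horner_nodal (fun=> 1)) // subrr.
- rewrite map_inj_in_uniq ?iota_uniq // => i j; rewrite !mem_iota /= => iN jN.
  exact: xi_inj.
- rewrite size_map size_iota (leq_trans (size_polyD _ _)) // geq_max.
  rewrite size_polyN size_poly1 andbT big_nat.
  apply: (big_ind (fun p : {poly R} => (size p <= N.+1)%N)).
  + by rewrite size_poly0.
  + by move=> p q pN qN; rewrite (leq_trans (size_polyD _ _)) // geq_max pN.
  + by move=> i /andP[_ iN]; have [->] := hh i iN.
Qed.

Lemma edge_poly0 : edge_poly h 0 = 0.
Proof. by rewrite /edge_poly big_nil oppr0. Qed.

Lemma edge_polyS i : edge_poly h i.+1 = edge_poly h i - (h i)^`().
Proof. by rewrite /edge_poly big_nat_recr //= opprD. Qed.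

Lemma edge_poly_last : edge_poly h N.+1 = 0.
Proof. by rewrite /edge_poly -raddf_sum /= sum_lagrange derivC oppr0. Qed.

Lemma deriv_nodal (a : nat -> R) :
  (\sum_(0 <= i < N.+1) a i *: h i)^`() =
  \sum_(1 <= i < N.+1) (a i - a i.-1) *: edge_poly h i.
Proof.
have dh i : (h i)^`() = edge_poly h i - edge_poly h i.+1.
  by rewrite edge_polyS opprB addrC subrK.
rewrite raddf_sum /=.
under eq_bigr do rewrite derivZ dh scalerBr.
under [RHS]eq_bigr do rewrite scalerBl.
rewrite !sumrB; congr (_ - _).
  by rewrite big_nat_recl // edge_poly0 scaler0 add0r big_add1.
by rewrite big_nat_recr //= edge_poly_last scaler0 addr0 big_add1.
Qed.

(** Linear independence of the edge polynomials as functions on [[-1, 1]]. *)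
Lemma edge_poly_free (c : nat -> R) :
  (forall x, -1 <= x <= 1 ->
     \sum_(1 <= i < N.+1) c i * (edge_poly h i).[x] = 0) ->
  forall i, (1 <= i <= N)%N -> c i = 0.
Proof.
move=> c0 [//|i] /= iN.
(* Nodal values whose successive differences are the given coefficients. *)
pose a i := \sum_(1 <= l < i.+1) c l.
have aB j : (0 < j)%N -> a j - a j.-1 = c j.
  by case: j => // j _; rewrite {1}/a big_nat_recr //= addrAC subrr add0r.
have da : (\sum_(0 <= i < N.+1) a i *: h i)^`() = 0.
  apply: poly_eq0_itv => x xI; rewrite deriv_nodal horner_sum -[RHS](c0 x xI).
  by apply: eq_big_nat => j /andP[j0 _]; rewrite hornerZ aB.
have := deriv_eq0_const _ _ (xi i.+1) (xi i) da.
rewrite (horner_nodal a _ iN) (horner_nodal a _ (ltnW iN)) => aS.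
by rewrite -(aB i.+1) //= aS subrr.
Qed.

Lemma derive1_nodal (a : nat -> R) (x : R) :
  derive1 (fun y : R => \sum_(0 <= i < N.+1) a i * (h i).[y]) x =
  \sum_(1 <= i < N.+1) (a i - a i.-1) * (edge_poly h i).[x].
Proof.
have -> : (fun y : R => \sum_(0 <= i < N.+1) a i * (h i).[y]) =
          horner (\sum_(0 <= i < N.+1) a i *: h i).
  by apply/funext => y; rewrite horner_sum; under [RHS]eq_bigr do rewrite hornerZ.
by rewrite -derivE deriv_nodal horner_sum; under eq_bigr do rewrite hornerZ.
Qed.

Lemma partial1_stress1 (T : nat -> nat -> nat -> R) (x1 x2 x3 : R) :
  partial1 (stress1 N h T) x1 x2 x3 =
  body_force N h (fun i j k => T i j k - T i.-1 j k) x1 x2 x3.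
Proof.
pose a i := \sum_(1 <= j < N.+1) \sum_(1 <= k < N.+1)
  T i j k * (edge_poly h j).[x2] * (edge_poly h k).[x3].
rewrite /partial1 /stress1.
under eq_fun => x.
  under eq_bigr => i _.
    rewrite (_ : (\sum_(1 <= j < N.+1) _) = a i * (h i).[x]); last first.
      rewrite /a mulr_suml; apply: eq_bigr => j _.
      by rewrite mulr_suml; apply: eq_bigr => k _; ring.
    over.
  over.
rewrite derive1_nodal; apply: eq_bigr => i _.
rewrite /a -sumrB mulr_suml; apply: eq_bigr => j _.
by rewrite -sumrB mulr_suml; apply: eq_bigr => k _; ring.
Qed.

Lemma stress2E (T : nat -> nat -> nat -> R) (x1 x2 x3 : R) :
  stress2 N h T x1 x2 x3 = stress1 N h (fun j i k => T i j k) x2 x1 x3.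
Proof.
rewrite /stress2 /stress1 exchange_big /=.
do 3![apply: eq_bigr => ? _]; ring.
Qed.

Lemma stress3E (T : nat -> nat -> nat -> R) (x1 x2 x3 : R) :
  stress3 N h T x1 x2 x3 = stress1 N h (fun k i j => T i j k) x3 x1 x2.
Proof.
rewrite /stress3 /stress1.
under eq_bigr do rewrite exchange_big /=.
rewrite exchange_big /=.
do 3![apply: eq_bigr => ? _]; ring.
Qed.

Lemma body_force_swap (F : nat -> nat -> nat -> R) (x1 x2 x3 : R) :
  body_force N h (fun j i k => F i j k) x2 x1 x3 = body_force N h F x1 x2 x3.
Proof.
rewrite /body_force exchange_big /=.
do 3![apply: eq_bigr => ? _]; ring.
Qed.

Lemma body_force_rot (F : nat -> nat -> nat -> R) (x1 x2 x3 : R) :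
  body_force N h (fun k i j => F i j k) x3 x1 x2 = body_force N h F x1 x2 x3.
Proof.
rewrite /body_force exchange_big /=.
under eq_bigr do rewrite exchange_big /=.
do 3![apply: eq_bigr => ? _]; ring.
Qed.

Lemma partial2_stress2 (T : nat -> nat -> nat -> R) (x1 x2 x3 : R) :
  partial2 (stress2 N h T) x1 x2 x3 =
  body_force N h (fun i j k => T i j k - T i j.-1 k) x1 x2 x3.
Proof.
rewrite /partial2; under eq_fun do rewrite stress2E.
rewrite -[LHS]/(partial1 (stress1 N h (fun j i k => T i j k)) x2 x1 x3).
by rewrite partial1_stress1 -[RHS]body_force_swap.
Qed.

Lemma partial3_stress3 (T : nat -> nat -> nat -> R) (x1 x2 x3 : R) :
  partial3 (stress3 N h T) x1 x2 x3 =
  body_force N h (fun i j k => T i j k - T i j k.-1) x1 x2 x3.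
Proof.
rewrite /partial3; under eq_fun do rewrite stress3E.
rewrite -[LHS]/(partial1 (stress1 N h (fun k i j => T i j k)) x3 x1 x2).
by rewrite partial1_stress1 -[RHS]body_force_rot.
Qed.

Lemma body_forceD (F G : nat -> nat -> nat -> R) (x1 x2 x3 : R) :
  body_force N h F x1 x2 x3 + body_force N h G x1 x2 x3 =
  body_force N h (fun i j k => F i j k + G i j k) x1 x2 x3.
Proof.
rewrite /body_force; do 3![rewrite -big_split; apply: eq_bigr => ? _ /=]; ring.
Qed.

(** Linear independence of the products of edge polynomials on the cube:
    [body_force N h F] serves here, as in the lemmas above, as the expansion in
    these products with an arbitrary coefficient array [F]. *)
Lemma body_force_eq0 (F : nat -> nat -> nat -> R) :
  (forall x1 x2 x3 : R, -1 <= x1 <= 1 -> -1 <= x2 <= 1 -> -1 <= x3 <= 1 ->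
     body_force N h F x1 x2 x3 = 0) <->
  (forall i j k, (1 <= i <= N)%N -> (1 <= j <= N)%N -> (1 <= k <= N)%N ->
     F i j k = 0).
Proof.
split=> [F0 i j k iN jN kN | F0 x1 x2 x3 _ _ _]; last first.
  rewrite /body_force; do 3![rewrite big_nat; apply: big1 => ? ?].
  by rewrite F0 // !mul0r.
apply: (edge_poly_free (F i j)) kN => x3 x3I.
pose c3 i j := \sum_(1 <= k < N.+1) F i j k * (edge_poly h k).[x3].
apply: (edge_poly_free (c3 i)) jN => x2 x2I.
pose c2 i := \sum_(1 <= j < N.+1) c3 i j * (edge_poly h j).[x2].
apply: (edge_poly_free c2) iN => x1 x1I.
rewrite -[RHS](F0 x1 x2 x3 x1I x2I x3I); apply: eq_bigr => i' _.
rewrite /c2 mulr_suml; apply: eq_bigr => j' _.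
by rewrite /c3 !mulr_suml; apply: eq_bigr => k' _; ring.
Qed.

End Edge.

Lemma GLL_nodes_inj (R : realType) (N : nat) (xi : nat -> R) :
  GLL_nodes N xi -> {in [pred i | (i <= N)%N] &, injective xi}.
Proof.
move=> [_ _ xi_lt _] i j /= iN jN; case: (ltngtP i j) => // ij eq_xi.
- by have := xi_lt i j; rewrite ij eq_xi ltxx => /(_ jN).
- by have := xi_lt j i; rewrite ij eq_xi ltxx => /(_ iN).
Qed.

Theorem mainTheorem2 (R : realType) (N : nat) (hN : (1 <= N)%N)
    (xi : nat -> R) (hxi : GLL_nodes N xi)
    (h : nat -> {poly R}) (hh : lagrange_polys N xi h)
    (T1 T2 T3 F : 'I_3 -> nat -> nat -> nat -> R) (m : 'I_3) :
  (forall x1 x2 x3 : R,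
      -1 <= x1 <= 1 -> -1 <= x2 <= 1 -> -1 <= x3 <= 1 ->
      partial1 (stress1 N h (T1 m)) x1 x2 x3
      + partial2 (stress2 N h (T2 m)) x1 x2 x3
      + partial3 (stress3 N h (T3 m)) x1 x2 x3
      + body_force N h (F m) x1 x2 x3 = 0)
  <->
  (forall i j k : nat,
      (1 <= i <= N)%N -> (1 <= j <= N)%N -> (1 <= k <= N)%N ->
      T1 m i j k - T1 m i.-1 j k
      + (T2 m i j k - T2 m i j.-1 k)
      + (T3 m i j k - T3 m i j k.-1)
      + F m i j k = 0).
Proof.
have xi_inj := GLL_nodes_inj _ _ _ hxi.
rewrite -(body_force_eq0 _ _ _ _ xi_inj hh (fun i j k =>
  T1 m i j k - T1 m i.-1 j k + (T2 m i j k - T2 m i j.-1 k)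
  + (T3 m i j k - T3 m i j k.-1) + F m i j k)).
have eqE x1 x2 x3 : partial1 (stress1 N h (T1 m)) x1 x2 x3
      + partial2 (stress2 N h (T2 m)) x1 x2 x3
      + partial3 (stress3 N h (T3 m)) x1 x2 x3
      + body_force N h (F m) x1 x2 x3 = body_force N h (fun i j k =>
        T1 m i j k - T1 m i.-1 j k + (T2 m i j k - T2 m i j.-1 k)
        + (T3 m i j k - T3 m i j k.-1) + F m i j k) x1 x2 x3.
  rewrite (partial1_stress1 _ _ _ _ xi_inj hh).
  rewrite (partial2_stress2 _ _ _ _ xi_inj hh).
  rewrite (partial3_stress3 _ _ _ _ xi_inj hh).
  by rewrite !body_forceD.
by split=> eq0 x1 x2 x3 x1I x2I x3I; have := eq0 x1 x2 x3 x1I x2I x3I;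
  rewrite eqE.
Qed.
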